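(* Let $\Gamma$ be a countably infinite abelian group, and suppose $[\Gamma:6\Gamma] = \infty$. Then for any $\varepsilon > 0$ and any Følner sequence $\Phi=(\Phi_N)$ in $\Gamma$, there exists $A \subseteq \Gamma$ with $\underline{d}_{\Phi}(A) > 1 - \varepsilon$ satisfying the following property: for any $t \in \Gamma$ and any $B \subseteq \Gamma$, if $B \oplus B \oplus B \subseteq A - t$, then $B$ is finite.
   Context: Here $6\Gamma = \{6\gamma : \gamma\in\Gamma\}$, $B\oplus B\oplus B = \{b_1+b_2+b_3 : b_1,b_2,b_3\in B \text{ (pairwise) distinct}\}$, and $A - t = \{a-t : a \in A\}$. A Følner sequence in $\Gamma$ is a sequence $(\Phi_N)$ of finite (nonempty) subsets of $\Gamma$ with $\lim_{N\to\infty} |\Phi_N \cap (\Phi_N+\gamma)|/|\Phi_N| = 1$ for every $\gamma \in \Gamma$. The lower density along $\Phi = (\Phi_N)$ is $\underline{d}_{\Phi}(A) = \liminf_{N\to\infty}\frac{|A\cap\Phi_N|}{|\Phi_N|}$. *)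

(* Defs.v *)
From HB Require Import structures.
From mathcomp Require Import all_boot all_order all_algebra finmap.
From mathcomp Require Import all_classical all_reals all_analysis.

Set Implicit Arguments.
Unset Strict Implicit.
Unset Printing Implicit Defensive.

Import Order.TTheory GRing.Theory Num.Theory.
Import numFieldNormedType.Exports.

Local Open Scope classical_set_scope.
Local Open Scope fset_scope.
Local Open Scope ring_scope.

Section Groups.
Variable G : zmodType.
Implicit Types A B H : set G.

Definition multiples (n : nat) : set G := range (fun g : G => g *+ n).

Definition translate A (t : G) : set G := [set a + t | a in A].

Definition cosets H : set (set G) := range (translate H).

(* [G : H] = oo, for H a subgroup *)
Definition infinite_index H : Prop := infinite_set (cosets H).

(* B (+) B (+) B: sums of three pairwise distinct elements of B *)
Definition distinct_sum3 B : set G :=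
  [set s | exists b1 b2 b3 : G,
     [/\ B b1, B b2 & B b3] /\
     [/\ b1 <> b2, b1 <> b3 & b2 <> b3] /\
     s = b1 + b2 + b3].

End Groups.

Section Folner.
Variables (R : realType) (G : zmodType).
Implicit Types Phi : nat -> {fset G}.

Definition Folner Phi : Prop :=
  (forall N, Phi N != fset0) /\
  (forall g : G,
     (fun N => #|` Phi N `&` [fset x + g | x in Phi N] |%:R
               / #|` Phi N|%:R : R) @ \oo --> (1 : R)).

Definition lower_density Phi (A : set G) : \bar R :=
  limn_einf (fun N =>
    (#|` [fset x in Phi N | x \in A]|%:R / #|` Phi N|%:R : R)%:E).

End Folner.

Arguments multiples G n : clear implicits.
Arguments Folner R {G} Phi.
Arguments lower_density R {G} Phi A.

(* Main.v *)
Require Import Defs.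
From HB Require Import structures.
From mathcomp Require Import all_boot all_order all_algebra finmap.
From mathcomp Require Import all_classical all_reals all_analysis.

Import Order.TTheory GRing.Theory Num.Theory.
Import numFieldNormedType.Exports.

Local Open Scope classical_set_scope.
Local Open Scope ring_scope.

(* As [6G] has infinite index, so has [pG] for [p = 2] or [p = 3], and there are
   finite-index subgroups [H] containing [pG] of arbitrarily large index. An
   infinite set has infinitely many elements in one coset of [H], and any [p] of
   these sum into [H]. So to prevent [t + B (+) B (+) B] from lying in [A] it is
   enough to remove from [A] a cofinite part of a coset of [H] through [t] when
   [p = 3], and through [t + b] for some [b] in [B] when [p = 2]. One such coset
   is removed for each element of [G], with indices growing fast enough that the
   total density removed is less than [eps]. *)

Set Implicit Arguments.
Unset Strict Implicit.

(** * Subgroups of large finite index containing [pG] *)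

Section Subgroups.
Variable G : zmodType.
Implicit Types H K : set G.

Definition subgroup H : Prop := H 0 /\ forall x y, H x -> H y -> H (x - y).

Lemma subgroupN H x : subgroup H -> H x -> H (- x).
Proof. by move=> [H0 HB] Hx; rewrite -sub0r; apply: HB. Qed.

Lemma subgroupD H x y : subgroup H -> H x -> H y -> H (x + y).
Proof. by move=> sH Hx Hy; rewrite -(opprK y); apply: sH.2 => //; exact: subgroupN. Qed.

Lemma subgroupMn H x n : subgroup H -> H x -> H (x *+ n).
Proof.
move=> sH Hx; elim: n => [|n IH]; first by rewrite mulr0n; exact: sH.1.
by rewrite mulrS; exact: subgroupD.
Qed.

Lemma subgroup_multiples n : subgroup (multiples G n).
Proof.
split; first by exists 0 => //; rewrite mul0rn.
by move=> _ _ [x _ <-] [y _ <-]; exists (x - y) => //; rewrite mulrnBl.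
Qed.

(** For a subgroup [H], having a covering list amounts to having finite index. *)
Definition covers H (T : seq G) := forall x, exists2 t, t \in T & H (x - t).

(** Greedy choice: the translates of [H] by the terms already chosen do not cover [G], so a further
    term exists outside them. *)
Lemma not_covers_sequence H :
  (forall T, ~ covers H T) ->
  forall k, exists s : nat -> G, forall i j, (i < j < k)%N -> ~ H (s j - s i).
Proof.
move=> nH; elim=> [|k [s sP]]; first by exists (fun=> 0) => i j; rewrite ltn0 andbF.
have [x xP] : exists x, forall t, t \in mkseq s k -> ~ H (x - t).
  apply: contrapT => h; apply: (nH (mkseq s k)) => x.
  apply: contrapT => h'; apply: h; exists x => t ts Ht.
  by apply: h'; exists t.
exists (fun i => if (i < k)%N then s i else x) => i j /andP[ij].
rewrite ltnS leq_eqVlt => /orP[/eqP jk|jk].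
  by subst j; rewrite ltnn ij; apply: xP; apply/mapP; exists i => //; rewrite mem_iota.
by rewrite jk (ltn_trans ij jk); apply: sP; rewrite ij.
Qed.

Lemma maximal_subgroup_avoiding K (D : seq G) : subgroup K ->
    (forall d, d \in D -> ~ K d) ->
  exists H, [/\ subgroup H, K `<=` H, (forall d, d \in D -> ~ H d) &
    forall H', subgroup H' -> H `<=` H' -> (forall d, d \in D -> ~ H' d) ->
      H' `<=` H].
Proof.
move=> sK KD.
pose good H := [/\ subgroup H, K `<=` H & forall d, d \in D -> ~ H d].
have [|H [[H0|gH] Hmax]] := @Zorn_bigcup G (fun H => H = set0 \/ good H).
- move=> F FP Ftot.
  have [[X [FX gX]]|nF] := pselect (exists X, F X /\ good X); last first.
    left; apply/seteqP; split=> // x [X FX Xx].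
    case: (FP _ FX) => [X0|gX]; first by rewrite X0 in Xx.
    by case: nF; exists X.
  right; split.
  + split; first by exists X => //; case: gX => -[].
    move=> x y [Y FY Yx] [Z FZ Zy].
    have [YZ|ZY] := Ftot _ _ FY FZ.
      exists Z => //; case: (FP _ FZ) => [Z0|[sZ _ _]].
        by rewrite Z0 in Zy.
      by apply: sZ.2 => //; apply: YZ.
    exists Y => //; case: (FP _ FY) => [Y0|[sY _ _]].
      by rewrite Y0 in Yx.
    by apply: sY.2 => //; apply: ZY.
  + by move=> x Kx; exists X => //; case: gX => _ KX _; apply: KX.
  + move=> d dD [Y FY Yd]; case: (FP _ FY) => [Y0|[_ _ YD]].
      by rewrite Y0 in Yd.
    exact: YD Yd.
- exfalso; apply: (Hmax K); last by right; split.
  rewrite H0 properEneq; split; last by [].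
  by apply/eqP => K0; have := sK.1; rewrite -K0.
- case: gH => sH KH HD; exists H; split=> // H' sH' HH' H'D x H'x.
  apply: contrapT => nHx; apply: (Hmax H').
    by split=> // H'H; apply: nHx; apply: H'H.
  by right; split=> //; apply: subset_trans HH'.
Qed.

(** Let [D] list the differences of [k] elements incongruent modulo [pG]. A subgroup maximal among
    those containing [pG] and avoiding [D] keeps these elements in distinct cosets, so its index is
    at least [k]; maximality forces the index to be finite. *)
Lemma finite_index_subgroup p k : prime p ->
    (forall T, ~ covers (multiples G p) T) ->
  exists H, [/\ subgroup H, multiples G p `<=` H, exists T, covers H T &
    exists s : nat -> G, forall i j, (i < j < k)%N -> ~ H (s j - s i)].
Proof.
move=> pp nH; have [s sP] := not_covers_sequence nH k.
pose D := [seq s ij.2 - s ij.1 |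
           ij <- [seq (i, j) | i <- iota 0 k, j <- iota 0 k] & (ij.1 < ij.2)%N].
have DP d : d \in D -> exists i j, (i < j < k)%N /\ d = s j - s i.
  move=> /mapP[[i j]]; rewrite mem_filter/= => /andP[ij].
  move=> /allpairsP[[i' j'] /= [_ jk []]] ? ? ->; subst i' j'.
  by exists i, j; rewrite mem_iota in jk; rewrite ij.
have [|H [sH pH HD Hmax]] := @maximal_subgroup_avoiding _ D (subgroup_multiples p).
  by move=> d /DP[i [j [ijk ->]]]; apply: sP.
exists H; split=> //; last first.
  exists s => i j /andP[ij jk]; apply: HD; apply/mapP; exists (i, j) => //.
  rewrite mem_filter/= ij; apply/allpairsP; exists (i, j) => /=.
  by rewrite !mem_iota /= jk (ltn_trans ij jk).
exists (0 :: [seq d *+ j | d <- D, j <- iota 0 p]) => x.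
have [Hx|nHx] := pselect (H x).
  by exists 0; rewrite ?mem_head ?subr0.
(* By maximality the subgroup [H + Zx] contains some [d] in [D]; as [p] kills
   [G / H], the relation [d = j x] modulo [H] can be inverted into [x = u d]. *)
pose H' := [set y | exists j, H (y - x *+ j)].
have Hp y n : (p %| n)%N -> H (y *+ n).
  by move=> /dvdnP[m ->]; rewrite mulrnA; apply: pH; exists (y *+ m).
have sH' : subgroup H'.
  split; first by exists 0; rewrite mulr0n subr0; exact: sH.1.
  (* As [H'] uses only natural multiples of [x], [p.-1 * j] stands in for [- j]: they differ by a
     multiple of [p]. *)
  move=> y z [i Hi] [j Hj]; exists (i + p.-1 * j)%N.
  have -> : y - z - x *+ (i + p.-1 * j)
            = (y - x *+ i) - (z - x *+ j) - x *+ (p * j).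
    rewrite -[in RHS](prednK (prime_gt0 pp)) mulSn !mulrnDr.
    have E (a b u v w : G) : a + u - (b + v) - (u + w) = a - b - (v + w).
      by rewrite !opprD addrACA addrK !addrA.
    by rewrite -{1}(subrK (x *+ i) y) -{1}(subrK (x *+ j) z) E.
  by apply: sH.2; [exact: sH.2|apply: Hp; exact: dvdn_mulr].
have [d dD [j Hdj]] : exists2 d, d \in D & H' d.
  apply: contrapT => nD; apply: nHx; apply: (Hmax H') => //.
  - by move=> y Hy; exists 0; rewrite mulr0n subr0.
  - by move=> d dD H'd; apply: nD; exists d.
  - by exists 1; rewrite mulr1n subrr; exact: sH.1.
have npj : ~~ (p %| j)%N.
  apply/negP => pj; apply: (HD _ dD).
  by rewrite -(subrK (x *+ j) d); apply: subgroupD => //; apply: Hp.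
have j0 : (0 < j)%N by case: j npj {Hdj} => //; rewrite dvdn0.
have cjp : coprime j p by rewrite coprime_sym prime_coprime.
case: (egcdnP p j0) => u v uv _.
have {uv} uv : (u * j = v * p + 1)%N by rewrite uv; congr addn; exact/eqP.
exists (d *+ (u %% p)).
  rewrite inE; apply/orP; right; apply/allpairsP; exists (d, (u %% p)%N) => /=.
  by rewrite dD mem_iota /= ltn_mod prime_gt0.
(* Since [u * j = v * p + 1], the multiples of [x] cancel up to [x]. Each term on the right lies in
   [H]: the outer two are multiples by [p], the middle one a multiple of [d - x *+ j]. *)
have -> : x - d *+ (u %% p) = d *+ (u %/ p * p) - (d - x *+ j) *+ u - x *+ (v * p).
  rewrite mulrnBl -mulrnA [(j * u)%N]mulnC uv mulrnDr mulr1n.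
  rewrite [in d *+ u](divn_eq u p) mulrnDr opprB.
  have E (a b w : G) : a + (w + x - (a + b)) - w = x - b.
    by rewrite addrCA opprD addNKr addrAC [w + x]addrC addrK.
  by rewrite E.
apply: sH.2; last by apply: Hp; exact: dvdn_mull.
by apply: sH.2; [apply: Hp; exact: dvdn_mull|exact: subgroupMn].
Qed.

(** From [x = 3x - 2x]: tripling [x - a] in [2G] and doubling [x - b] in [3G] both give elements of
    [6G]. *)
Lemma covers_multiples6 T2 T3 : covers (multiples G 2) T2 ->
    covers (multiples G 3) T3 ->
  covers (multiples G 6) [seq a *+ 3 - b *+ 2 | a <- T2, b <- T3].
Proof.
move=> c2 c3 x; have [a aT [u _ ux]] := c2 x; have [b bT [v _ vx]] := c3 x.
exists (a *+ 3 - b *+ 2); first by apply/allpairsP; exists (a, b).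
exists (u - v) => //; rewrite mulrnBl (mulrnA u 2 3) (mulrnA v 3 2) ux vx.
have E (q r w : G) : x + w - q - (w - r) = x - (q - r).
  by rewrite !opprB addrC addrA [x + w]addrC addrA subrK -addrA addrCA.
by rewrite !mulrnBl (mulrS x 2) E.
Qed.

Lemma infinite_index_not_covers H T : subgroup H -> infinite_index H -> ~ covers H T.
Proof.
move=> sH iH cT; apply: iH.
apply: (@sub_finite_set _ _ (translate H @` [set` T])); last first.
  by apply: finite_image; exact: finite_seq.
move=> _ [x _ <-]; have [t tT Hxt] := cT x; exists t => //.
apply/seteqP; split=> _ [h Hh <-].
  exists (h - (x - t)); first exact: sH.2.
  by rewrite opprB addrA subrK.
by exists (h + (x - t)); [exact: subgroupD|rewrite -addrA subrK].
Qed.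

Lemma infinite_index6_prime : infinite_index (multiples G 6) ->
  exists p, (p = 2 \/ p = 3)%N /\ forall T, ~ covers (multiples G p) T.
Proof.
move=> i6; apply: contrapT => h.
have c p : (p = 2 \/ p = 3)%N -> exists T, covers (multiples G p) T.
  by move=> pp; apply: contrapT => /forallNP nT; apply: h; exists p.
have [T2 c2] := c _ (or_introl erefl); have [T3 c3] := c _ (or_intror erefl).
exact: infinite_index_not_covers (subgroup_multiples 6) i6 (covers_multiples6 c2 c3).
Qed.

End Subgroups.

(** * Counting translates in Følner sets and bounding densities *)

Section Density.
Local Open Scope fset_scope.
Local Open Scope ring_scope.
Variables (R : realType) (G : zmodType).
Implicit Types (X : {fset G}) (A Y : set G) (Phi : nat -> {fset G}).

Lemma card_fset_cond X (P : pred G) :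
  #|` [fset x in X | P x]| = (\sum_(x <- X) P x)%N.
Proof.
rewrite finmap.card_fset_sum1 -big_fset_condE/= big_mkcond/=.
by apply: eq_bigr => x _; case: (P x).
Qed.

(** After a shift by [s], a point of [X] in [Y] either remains in [X], where the first term counts
    it, or lands in the part of [X + s] outside [X], whose size is the second term. *)
Lemma card_fset_cond_translate X Y (s : G) :
  (#|` [fset x in X | x \in Y]| <= #|` [fset x in X | (x - s)%R \in Y]| +
    (#|` X| - #|` X `&` [fset (x + s)%R | x in X]|))%N.
Proof.
have cardD (B : {fset G}) : #|` [fset (x + s)%R | x in B]| = #|` B|.
  by rewrite card_imfset//; exact: addIr.
rewrite -(cardD [fset x in X | x \in Y]).
rewrite -[in X in (_ + (X - _))%N](cardD X) fsetIC -cardfsD.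
apply: (@leq_trans #|` [fset x in X | (x - s)%R \in Y] `|`
                      ([fset (x + s)%R | x in X] `\` X)|%N); last first.
  by rewrite cardfsU leq_subr.
apply: fsubset_leq_card; apply/fsubsetP => _ /imfsetP[x /= + ->].
rewrite !inE/= => /andP[xX xY]; rewrite addrK xY andbT.
by case: (_ \in X) => //=; apply/imfsetP; exists x.
Qed.

(** Each point of [X] lies in at most one of the translates [Y + s i], so summing the previous bound
    over [i < k] counts it at most once. *)
Lemma card_fset_disjoint_translates X Y k (s : nat -> G) :
    (forall i j x, (i < j < k)%N -> Y (x - s i) -> ~ Y (x - s j)) ->
  (k * #|` [fset x in X | x \in Y]| <=
    #|` X| + \sum_(i < k) (#|` X| - #|` X `&` [fset (x + s i)%R | x in X]|))%N.
Proof.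
move=> dY; rewrite -[k in (k * _)%N]card_ord -sum_nat_const.
apply: leq_trans; first by apply: leq_sum => i _; exact: card_fset_cond_translate (s i).
rewrite big_split/= leq_add2r.
under eq_bigr do rewrite card_fset_cond.
rewrite exchange_big/= finmap.card_fset_sum1; apply: leq_sum => x _.
have [/existsP[i xi]|/existsPn n] := boolP [exists i : 'I_k, x - s i \in Y].
  rewrite (bigD1 i)//= xi big1// => j ji; apply/eqP; rewrite eqb0.
  apply/negP; rewrite inE => xj; rewrite inE in xi.
  have : (i < j)%N || (j < i)%N by rewrite -neq_ltn eq_sym.
  case/orP => ij; first by apply: (dY i j x) => //; rewrite ij /=.
  by apply: (dY j i x) => //; rewrite ij /=.
by rewrite big1// => i _; apply/eqP; rewrite eqb0.
Qed.

(** The [2] is [1 + 1]: one [|Phi N|] comes from disjointness, and another bounds the sum of the [k]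
    boundary terms, each eventually at most [|Phi N| / k]. *)
Lemma near_disjoint_translates Phi Y k (s : nat -> G) : Folner R Phi ->
    (0 < k)%N ->
    (forall i j x, (i < j < k)%N -> Y (x - s i) -> ~ Y (x - s j)) ->
  \forall N \near \oo, #|` [fset x in Phi N | x \in Y]|%:R <=
    2 / k%:R * #|` Phi N|%:R :> R.
Proof.
move=> [Phi0 PhiF] k0 dY.
have kR : 0 < k%:R :> R by rewrite ltr0n.
have near1 : \forall N \near \oo, forall i : 'I_k, 1 - k%:R^-1 <=
    #|` Phi N `&` [fset x + s i | x in Phi N]|%:R / #|` Phi N|%:R :> R.
  apply: filter_forall => i; apply: (cvgr_ge _ (PhiF (s i))).
  by rewrite ltrBlDr ltrDl invr_gt0.
apply: filterS near1 => N hN.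
have PN : 0 < #|` Phi N|%:R :> R by rewrite ltr0n cardfs_gt0.
rewrite mulrAC ler_pdivlMr// mulrC -natrM.
have := card_fset_disjoint_translates (Phi N) dY.
rewrite -(ler_nat R) => /le_trans; apply.
rewrite natrD natr_sum mulr_natl mulr2n lerD2l.
apply: (@le_trans _ _ (\sum_(i < k) #|` Phi N|%:R / k%:R)); last first.
  by rewrite sumr_const card_ord -[leLHS]mulr_natr divfK ?gt_eqF.
apply: ler_sum => i _.
rewrite natrB; last by apply: fsubset_leq_card; exact: fsubsetIl.
have := hN i; rewrite ler_pdivlMr// mulrBl mul1r => h.
by rewrite lerBlDr addrC -lerBlDr mulrC.
Qed.

(** The bounds hold on the finite set [X] itself, not just in a limit, so countably many can be
    added: each point of [X] in the union is charged to one index, and the geometric weights sum to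
    at most [e]. *)
Lemma card_fset_bigcup_le (A_ : nat -> set G) X (e : R) : 0 <= e ->
    (forall n, #|` [fset x in X | x \in A_ n]|%:R
                 <= e / 2 ^+ n.+1 * #|` X|%:R) ->
  #|` [fset x in X | x \in \bigcup_n A_ n]|%:R <= e * #|` X|%:R.
Proof.
move=> e0 hA.
have /choice[m hm] : forall x, exists n, (\bigcup_n A_ n) x -> A_ n x.
  move=> x.
  have [[n _ Anx]|nA] := pselect ((\bigcup_n A_ n) x); first by exists n.
  by exists 0%N.
(* The sum serves as a strict upper bound for all [m x] with [x] in [X]. *)
pose M := (\sum_(x <- X) (m x).+1)%N.
have mM x : x \in X -> (m x < M)%N.
  by move=> xX; rewrite /M (big_fsetD1 x)//= leq_addr.
have geo K : \sum_(n < K) (e / 2 ^+ n.+1 : R) = e - e / 2 ^+ K.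
  elim: K => [|K IH]; first by rewrite big_ord0 expr0 divr1 subrr.
  rewrite big_ord_recr/= IH -addrA; congr (_ + _).
  rewrite [in X in - X + _](_ : e / 2 ^+ K = e / 2 ^+ K.+1 *+ 2).
    by rewrite mulr2n opprD addrNK.
  by rewrite exprS invfM mulrCA -[RHS]mulr_natl mulVKf ?pnatr_eq0.
apply: (@le_trans _ _ (\sum_(n < M) e / 2 ^+ n.+1 * #|` X|%:R)); last first.
  rewrite -mulr_suml geo ler_wpM2r// lerBlDr lerDl.
  by rewrite divr_ge0// exprn_ge0.
apply: (@le_trans _ _ (\sum_(n < M) #|` [fset x in X | x \in A_ n]|%:R)).
  rewrite -natr_sum ler_nat; under eq_bigr do rewrite card_fset_cond.
  rewrite card_fset_cond exchange_big/= big_seq [leqRHS]big_seq.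
  apply: leq_sum => x xX; case: (boolP (x \in _)) => //; rewrite inE => /hm Ax.
  by rewrite (bigD1 (Ordinal (mM _ xX)))//= mem_set.
by apply: ler_sum => n _; exact: hA.
Qed.

Lemma lower_density_ge Phi A (c : R) :
    (forall N, c <= #|` [fset x in Phi N | x \in A]|%:R / #|` Phi N|%:R) ->
  (c%:E <= lower_density R Phi A)%E.
Proof.
move=> cA; rewrite /lower_density limn_einf_lim; apply: lime_ge.
  exact: is_cvg_einfs.
apply: nearW => N; apply: le_ereal_inf_tmp => _ [n /= _ <-].
by rewrite lee_fin.
Qed.

End Density.

(** * Sums of elements of an infinite set *)

Section InfiniteSets.
Variable G : zmodType.
Implicit Types (H B F : set G) (T : seq G).

(** Fix [n] distinct elements first. Only finitely many values of the last one repeat an earlier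
    element or bring the sum into [F]. *)
Lemma infinite_set_sum_notin B F n : infinite_set B -> finite_set F ->
  exists s : seq G,
    [/\ size s = n.+1, uniq s, forall x, x \in s -> B x & ~ F (\sum_(x <- s) x)].
Proof.
move=> iB fF; have [X XB nX] := infinite_set_fset n iB.
pose s := take n X.
have sX x : x \in s -> B x by move=> /mem_take xX; exact: XB.
have [x [Bx nx]] : B `\` ([set` s] `|` [set y - \sum_(z <- s) z | y in F]) !=set0.
  apply/infinite_setN0/infinite_setD => //.
  by rewrite finite_setU; split; [exact: finite_seq|exact: finite_image].
exists (x :: s); split.
- by rewrite /= size_takel.
- rewrite /= take_uniq ?fset_uniq// andbT; apply/negP => xs.
  by apply: nx; left.
- by move=> y; rewrite inE => /orP[/eqP->//|]; exact: sX.
- by rewrite big_cons => Fx; apply: nx; right; exists (x + \sum_(z <- s) z);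
    rewrite ?addrK.
Qed.

Lemma infinite_set_coset H T B : covers H T -> infinite_set B ->
  exists t, infinite_set (B `&` [set x | H (x - t)]).
Proof.
move=> cT iB; apply: contrapT => /forallNP nt; apply: iB.
apply: (@sub_finite_set _ _ (\bigcup_(t in [set` T]) (B `&` [set x | H (x - t)]))).
  by move=> x Bx; have [t tT Hxt] := cT x; exists t.
by apply: bigcup_finite => [|t _]; [exact: finite_seq|exact: contrapT (nt t)].
Qed.

(** Modulo [H] the sum is [t *+ p], which lies in [pG]. *)
Lemma subgroup_sum_coset H p t (s : seq G) : subgroup H ->
    multiples G p `<=` H -> size s = p -> (forall x, x \in s -> H (x - t)) ->
  H (\sum_(x <- s) x).
Proof.
move=> sH pH sp Hs.
suff HB : H (\sum_(x <- s) x - t *+ p).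
  rewrite -(subrK (t *+ p) (\sum_(x <- s) x)).
  by apply: subgroupD => //; apply: pH; exists t.
rewrite -{}sp {pH}.
elim: s Hs => [|x s IH] Hs /=.
  by rewrite big_nil mulr0n subr0; exact: sH.1.
rewrite big_cons mulrS opprD addrACA; apply: subgroupD => //.
  by apply: Hs; rewrite mem_head.
by apply: IH => y ys; apply: Hs; rewrite inE ys orbT.
Qed.

End InfiniteSets.

(* A coset [g + H] of a subgroup of large finite index, deprived of the finitely
   many [Phi N] along which its density is not yet small. *)
Lemma sparse_set_of_sums (R : realType) (G : zmodType) (Phi : nat -> {fset G})
    (p : nat) (g : G) (e : R) :
    prime p -> (forall T, ~ covers (multiples G p) T) -> Folner R Phi -> 0 < e ->
  exists A : set G,
    (forall N, #|` [fset x in Phi N | x \in A]%fset|%:R <= e * #|` Phi N|%:R) /\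
    (forall B : set G, infinite_set B ->
       exists s : seq G, [/\ size s = p, uniq s, forall x, x \in s -> B x &
                            A (g + \sum_(x <- s) x)]).
Proof.
move=> pp np FPhi e0.
pose k := (Num.truncn (2 / e)).+1.
have ke : 2 / k%:R <= e.
  rewrite ler_pdivrMr ?ltr0n// mulrC -ler_pdivrMr//.
  exact: ltW (truncnS_gt _).
have [H [sH pH [T cT] [s sP]]] := finite_index_subgroup k pp np.
(* The translates of [g + H] by the [s i] are distinct cosets, hence disjoint, so the density bound
   [2 / k] applies. *)
have [|M _ hM] := @near_disjoint_translates _ _ Phi [set x | H (x - g)] k s FPhi erefl.
  move=> i j x /sP nH /= Hi Hj; apply: nH.
  have := sH.2 _ _ Hi Hj; congr H.
  by rewrite opprB addrA subrK opprB addrC addrA subrK.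
(* Removing [Phi N] for [N < M] makes the bound hold at every [N], as needed for adding countably
   many such bounds. *)
exists [set x | H (x - g) /\ forall N, (N < M)%N -> x \notin Phi N]; split.
  move=> N; have [NM|MN] := ltnP N M.
    rewrite (_ : [fset x in _ | _]%fset = fset0) ?cardfs0.
      by rewrite mulr_ge0// ltW.
    apply/fsetP => x; rewrite !inE; apply/negP => /andP[xN].
    by rewrite inE => -[_ /(_ _ NM)]; rewrite xN.
  apply: (le_trans _ (ler_wpM2r _ ke)) => //.
  apply: le_trans (hM N MN); rewrite ler_nat; apply: fsubset_leq_card.
  apply/fsubsetP => x; rewrite !inE/= => /andP[-> /=].
  by rewrite !inE/= => -[].
move=> B iB; have [t iBt] := infinite_set_coset cT iB.
(* The sum must avoid the removed points shifted by [- g]. The argument [p.-1] yields a list of [p]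
   elements. *)
have [|r [sr ur rB rF]] := @infinite_set_sum_notin _ _
    (\bigcup_(N in `I_M) [set x - g | x in [set` Phi N]]) p.-1 iBt.
  apply: bigcup_finite => [|N _]; first exact: finite_II.
  exact/finite_image/finite_fset.
rewrite prednK ?prime_gt0// in sr.
exists r; split=> //; first by move=> x /rB[].
split=> /=.
  rewrite addrC addKr; apply: (subgroup_sum_coset sH pH sr (t := t)).
  by move=> x /rB[].
move=> N NM; apply/negP => xN; apply: rF; exists N => //.
by exists (g + \sum_(x <- r) x) => //; rewrite addrC addKr.
Qed.

(** * Construction of [A] and the two cases [p = 2] and [p = 3] *)

Unset Implicit Arguments.
Set Strict Implicit.

Theorem proposition1p12 (R : realType) (G : zmodType)
    (G_countable : countable [set: G]) (G_infinite : infinite_set [set: G])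
    (index_6G : infinite_index (multiples G 6))
    (eps : R) (eps_gt0 : 0 < eps)
    (Phi : nat -> {fset G}) (Phi_Folner : Folner R Phi) :
  exists A : set G,
    ((1 - eps)%:E < lower_density R Phi A)%E /\
    (forall (t : G) (B : set G),
       distinct_sum3 B `<=` translate A (- t) -> finite_set B).
Proof.
have [p [p23 np]] := infinite_index6_prime index_6G.
have pp : prime p by case: p23 => ->.
have [g gP] : exists g : nat -> G, forall x, exists n, g n = x.
  have /pfcard_geP[G0|[g]] := G_countable.
    by case: G_infinite; rewrite G0; exact: finite_set0.
  by exists g => x; have [n _ <-] := @surj _ _ _ _ g x I; exists n.
(* A total allowance of [eps / 2] leaves room for the strict inequality. The set [E n] serves the
   element [g n] and gets the share [1 / 2 ^+ n.+1] of it. *)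
have e2 : 0 < eps / 2 by rewrite divr_gt0.
have /choice[E EP] := fun n => sparse_set_of_sums (g n) pp np Phi_Folner
  (divr_gt0 e2 (exprn_gt0 n.+1 (ltr0Sn R 1))).
have hE N := card_fset_bigcup_le (ltW e2) (fun n => (EP n).1 N).
exists (~` \bigcup_n E n); split.
  apply: (@lt_le_trans _ _ (1 - eps / 2)%:E).
    by rewrite lte_fin ltrD2l ltrN2 gtr_pMr// invf_lt1// ltr1n.
  apply: lower_density_ge => N.
  have PN : 0 < #|` Phi N|%:R :> R by rewrite ltr0n cardfs_gt0 Phi_Folner.1.
  rewrite ler_pdivlMr// mulrBl mul1r lerBlDr.
  apply: le_trans (lerD (lexx _) (hE N)); rewrite -natrD ler_nat.
  rewrite !card_fset_cond -big_split/= finmap.card_fset_sum1.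
  by apply: leq_sum => x _; rewrite in_setC; case: (_ \in _).
move=> t B BA; apply: contrapT => iB.
(* It is enough to find a sum of three distinct elements of [B] whose shift by [t] was removed from
   [A]. *)
suff [n [b1 [b2 [b3 [Bs [ds Es]]]]]] : exists n b1 b2 b3,
    [/\ B b1, B b2 & B b3] /\ [/\ b1 <> b2, b1 <> b3 & b2 <> b3] /\
    E n (t + (b1 + b2 + b3)).
  have [|a nEa ab] := BA (b1 + b2 + b3); first by exists b1, b2, b3.
  by apply: nEa; exists n => //; rewrite -(subrK t a) ab addrC.
case: p23 => p_eq; rewrite {p}p_eq in np pp EP.
  (* For [p = 2] one summand [b] is absorbed into the base point [t + b]; the other two are taken
     from [B] without [b], so all three are distinct. *)
  have [b Bb] := infinite_setN0 iB; have [n gn] := gP (t + b).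
  have iBb : infinite_set (B `\ b) by apply: infinite_setD; first exact: iB.
  have [s [+ + sB Es]] := (EP n).2 _ iBb.
  case: s sB Es => [|x [|y [|? ?]]] //= sB Es _.
  rewrite inE andbT => /eqP xy; exists n, x, y, b.
  have [Bx xb] := sB x (mem_head _ _).
  have [|By yb] := sB y; first by rewrite !inE eqxx orbT.
  do 2 split=> //.
  by move: Es; rewrite !big_cons big_nil addr0 gn -addrA [b + _]addrC.
(* For [p = 3] the base point is [t] itself, and all three summands come from the list. *)
have [n gn] := gP t; have [s [+ + sB Es]] := (EP n).2 _ iB.
case: s sB Es => [|x [|y [|z [|? ?]]]] //= sB Es _.
rewrite !inE negb_or andbT => /andP[/andP[/eqP xy /eqP xz] /eqP yz].
exists n, x, y, z; split; first by split; apply: sB; rewrite !inE eqxx ?orbT.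
split=> //; move: Es; rewrite !big_cons big_nil addr0 gn => Es.
by rewrite -(addrA x).
Qed.
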